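(* Let $K$ be an algebraically closed field and let $A$ be a finite-dimensional $K$-algebra of finite global dimension. Let $(P_i)_{i\in I}$ be representatives of the isomorphism classes of indecomposable projective $A$-modules, $(S_i)_{i \in I}$ representatives of the isomorphism classes of simple $A$-modules, and $S = \bigoplus_{i\in I} S_i$. Then $I$ is finite, the matrix $Z_A = (Z_{ij})_{i,j\in I}$ with $Z_{ij} = \dim_K \operatorname{Hom}_A(P_i,P_j)$ is invertible, so that the magnitude $|\mathrm{IP}(A)|$ is defined, and \[ |\mathrm{IP}(A)| = \sum_{n=0}^{\infty} (-1)^n \dim_K \operatorname{Ext}^n_A(S,S). \]
   Context: Modules are finitely generated left $A$-modules. $\mathrm{IP}(A)$ denotes the $K$-linear category whose objects are the indecomposable projective $A$-modules and whose morphisms are all $A$-module homomorphisms; it is equivalent to its full subcategory on the objects $P_i$ ($i\in I$). Magnitude of a linear category: for a $K$-linear category $\mathcal{B}$ with finitely many objects and finite-dimensional hom-spaces, let $Z_{\mathcal B}$ be the matrix indexed by objects with $(a,b)$-entry $\dim_K \mathcal{B}(a,b)$; if $Z_{\mathcal B}$ is invertible (over $\mathbb{Q}$), the magnitude $|\mathcal{B}|$ is the sum of all entries of $Z_{\mathcal B}^{-1}$. For a linear category $\mathcal{A}$ equivalent to such a $\mathcal{B}$ with invertible $Z_{\mathcal B}$, one sets $|\mathcal{A}| = |\mathcal{B}|$. Thus $|\mathrm{IP}(A)|$ is the sum of the entries of $Z_A^{-1}$. Finite global dimension means $\operatorname{Ext}^n_A = 0$ for all sufficiently large $n$, so the sum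 is finite. *)

(* Defs.v *)
From HB Require Import structures.
From mathcomp Require Import all_boot all_order all_algebra all_field.

Set Implicit Arguments.
Unset Strict Implicit.
Unset Printing Implicit Defensive.

Import Order.TTheory GRing.Theory Num.Theory.
Local Open Scope ring_scope.

(* A finitely generated (= finite-dimensional) left A-module, given by its
   K-dimension d and the action map a |-> rho(a) : 'M_d, in the row-vector
   convention: a . v := v *m rho a  (v : 'rV_d). *)
Record amod (K : fieldType) (A : falgType K) := AMod {
  mdim : nat;
  mact : A -> 'M[K]_mdim }.

Arguments AMod {K A} mdim mact.

Section Modules.
Variables (K : fieldType) (A : falgType K).

Definition is_amod (M : amod A) : Prop :=
  [/\ forall (k : K) (a b : A), mact M (k *: a + b) = k *: mact M a + mact M b,
      forall a b : A, mact M (a * b) = mact M b *m mact M a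
    & mact M 1 = 1%:M].

Definition is_hom (M N : amod A) (f : 'M[K]_(mdim M, mdim N)) : Prop :=
  forall a : A, mact M a *m f = f *m mact N a.

Definition iso (M N : amod A) : Prop :=
  exists (f : 'M[K]_(mdim M, mdim N)) (g : 'M[K]_(mdim N, mdim M)),
    [/\ is_hom f, is_hom g, f *m g = 1%:M & g *m f = 1%:M].

Definition abasis : (\dim (fullv : {vspace A})).-tuple A := vbasis fullv.
Notation m := (\dim (fullv : {vspace A})).

(* Hom_A(M, N) as a K-subspace of 'M_(dim M, dim N): the common kernel of the
   (linear) maps f |-> rho_M(e) f - f rho_N(e), e ranging over a K-basis of A
   (equivalently over all of A, by linearity of the action). *)
Definition hom_defect (M N : amod A) (f : 'M[K]_(mdim M, mdim N)) :
  {ffun 'I_m -> 'M[K]_(mdim M, mdim N)} :=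
  [ffun i => mact M (tnth abasis i) *m f - f *m mact N (tnth abasis i)].

Definition homspace (M N : amod A) : {vspace 'M[K]_(mdim M, mdim N)} :=
  lker (linfun (@hom_defect M N)).

Definition homdim (M N : amod A) : nat := \dim (homspace M N).

Definition simple (M : amod A) : Prop :=
  (0 < mdim M)%N /\
  forall U : 'M[K]_(mdim M),
    (forall a : A, (U *m mact M a <= U)%MS) ->
    \rank U = 0%N \/ \rank U = mdim M.

Definition indecomposable (M : amod A) : Prop :=
  (0 < mdim M)%N /\
  forall e : 'M[K]_(mdim M), is_hom e -> e *m e = e -> e = 0 \/ e = 1%:M.

Definition projective (M : amod A) : Prop :=
  forall (N N' : amod A) (p : 'M[K]_(mdim N, mdim N')) (f : 'M[K]_(mdim M, mdim N')),
    is_amod N -> is_amod N' -> is_hom p -> row_full p -> is_hom f ->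
    exists g : 'M[K]_(mdim M, mdim N), is_hom g /\ g *m p = f.

Definition dsum (M N : amod A) : amod A :=
  AMod (mdim M + mdim N) (fun a => block_mx (mact M a) 0 0 (mact N a)).

Definition zero_mod : amod A := AMod 0 (fun _ => 0).

Definition bigdsum (s : seq (amod A)) : amod A := foldr dsum zero_mod s.

(* ---- Ext via the (unnormalized) bar resolution ---------------------------
   Ext^n_A(M, N) = H^n of the complex C^n = Hom_K(A^{(x)n} (x) M, N) with
   (d f)(a_1..a_{n+1}, v) = a_1 f(a_2..a_{n+1}, v)
        + sum_{i=1}^n (-1)^i f(a_1..a_i a_{i+1}..a_{n+1}, v)
        + (-1)^{n+1} f(a_1..a_n, a_{n+1} v).
   A cochain is determined by its values on basis tuples (e_{t_1},...,e_{t_n});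
   its value there is a K-linear map M -> N, i.e. a matrix. *)
Definition cochain (M N : amod A) (n : nat) :=
  {ffun n.-tuple 'I_m -> 'M[K]_(mdim M, mdim N)}.

Definition tup_tail n (t : n.+1.-tuple 'I_m) : n.-tuple 'I_m :=
  [tuple tnth t (lift ord0 i) | i < n].
Definition tup_front n (t : n.+1.-tuple 'I_m) : n.-tuple 'I_m :=
  [tuple tnth t (widen_ord (leqnSn n) i) | i < n].
Definition tup_merge n (t : n.+1.-tuple 'I_m) (k : 'I_n) (j : 'I_m) :
  n.-tuple 'I_m :=
  [tuple (if (i < k)%N then tnth t (widen_ord (leqnSn n) i)
          else if i == k then j else tnth t (lift ord0 i)) | i < n].

Definition bar_diff (M N : amod A) (n : nat) (F : cochain M N n) :
  cochain M N n.+1 :=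
  [ffun t : n.+1.-tuple 'I_m =>
     F (tup_tail t) *m mact N (tnth abasis (tnth t ord0))
   + \sum_(k < n) (-1) ^+ k.+1 *:
        \sum_(j < m) coord abasis j
            (tnth abasis (tnth t (widen_ord (leqnSn n) k))
             * tnth abasis (tnth t (lift ord0 k))) *: F (tup_merge t k j)
   + (-1) ^+ n.+1 *: (mact M (tnth abasis (tnth t ord_max)) *m F (tup_front t))].

Definition extdim (M N : amod A) (n : nat) : nat :=
  match n with
  | 0 => \dim (lker (linfun (@bar_diff M N 0)))
  | n'.+1 => (\dim (lker (linfun (@bar_diff M N n'.+1)))
               - \dim (limg (linfun (@bar_diff M N n'))))%N
  end.

Definition finite_gldim : Prop :=
  exists n0 : nat, forall M N : amod A, is_amod M -> is_amod N ->
    forall n, (n0 <= n)%N -> extdim M N n = 0%N.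

End Modules.

Definition magnitude (n : nat) (Z : 'M[rat]_n) : rat :=
  \sum_(i < n) \sum_(j < n) invmx Z i j.

(* Main.v *)
(* Write chi(M, N) for the alternating sum of the dimensions of Ext^n(M, N).
   Since chi(P, N) = dim Hom(P, N) for P projective, and both chi(-, N) and
   Hom(P, -) are additive on short exact sequences, the multiplicities
   c_ik = [P_i : S_k] satisfy c E = D and Z = D c^T, where E_kj = chi(S_k, S_j)
   and D_ij = dim Hom(P_i, S_j).  By Fitting's and Schur's lemmas each P_i has a
   unique simple quotient, occurring once, so D is a permutation matrix; hence Z
   is invertible.  Also c x = (1, ..., 1) for x_k = chi(S_k, S), so the entries of
   Z^-1 sum to the sum of the x_k, which is chi(S, S).

   Additivity of chi needs no long exact sequence: in each degree the rank of the
   bar differential is superadditive on short exact sequences, and where Ext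
   vanishes the defects of additivity in consecutive degrees cancel, so they are
   zero and dimension counting in the truncated bar complex suffices. *)
Require Import Defs.
From HB Require Import structures.
From mathcomp Require Import all_boot all_order all_algebra all_field.
From mathcomp Require Import fingroup perm zify ring boolp.
Import Order.TTheory GRing.Theory Num.Theory.
Local Open Scope ring_scope.

Set Implicit Arguments.
Unset Strict Implicit.
Unset Printing Implicit Defensive.

(** * Free modules *)

Section FreeModules.
Variables (K : fieldType) (A : falgType K).
Notation m := (\dim (fullv : {vspace A})).
Notation "''b_' i" := (tnth (abasis A) i) (at level 8, i at level 2).
Implicit Types M N : amod A.

Lemma coord_abasis (a : A) : a = \sum_(i < m) coord (abasis A) i a *: 'b_i.
Proof.
rewrite [LHS](coord_vbasis (memvf a)).
by apply: eq_bigr => i _; rewrite -tnth_nth.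
Qed.

Lemma coord_abasis_basis i j : coord (abasis A) i 'b_j = (i == j)%:R.
Proof.
rewrite (tnth_nth 0) coord_free; first by rewrite eq_sym.
exact: basis_free (vbasisP _).
Qed.

Lemma mact_linear M : is_amod M ->
  forall (I : Type) (r : seq I) (c : I -> K) (a : I -> A),
  mact M (\sum_(i <- r) c i *: a i) = \sum_(i <- r) c i *: mact M (a i).
Proof.
case=> linM _ _ I r c a; elim: r => [|i r IH]; last first.
  by rewrite !big_cons linM IH.
rewrite !big_nil; have := linM (-1) 0 0.
by rewrite scaler0 addr0 scaleN1r addNr.
Qed.

Lemma mact_coord M (a : A) : is_amod M ->
  mact M a = \sum_(i < m) coord (abasis A) i a *: mact M 'b_i.
Proof. by move=> MM; rewrite {1}(coord_abasis a) mact_linear. Qed.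

(** A vector of A (x) K^d is an m-by-d matrix flattened by [mxvec], one row per basis element of A;
    [inj_at] includes row [l] and [proj_at] extracts it. *)
Definition inj_at d (l : 'I_m) : 'M[K]_(d, m * d) :=
  lin1_mx (mxvec \o mulmx (delta_mx l (0 : 'I_1))).
Definition proj_at d (l : 'I_m) : 'M[K]_(m * d, d) := lin1_mx (row l \o vec_mx).
Arguments inj_at d l : clear implicits.
Arguments proj_at d l : clear implicits.

Lemma inj_proj d l j : inj_at d l *m proj_at d j = (l == j)%:R%:M.
Proof.
apply/row_matrixP => i; rewrite !rowE mulmxA !mul_rV_lin1 /= mxvecK.
rewrite row_mul rowE mul_delta_mx_cond mul_mx_scalar eq_sym.
case: eqP => _; last by rewrite mulr0n scale0r mul0mx.
by rewrite mulr1n scale1r mul_delta_mx.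
Qed.

Lemma sum_proj_inj d : \sum_l proj_at d l *m inj_at d l = 1%:M.
Proof.
apply/row_matrixP => i; rewrite !rowE mulmx1 mulmx_sumr.
set v := delta_mx _ _.
under eq_bigr do rewrite mulmxA !mul_rV_lin1 /=.
rewrite -linear_sum /= -[RHS]vec_mxK; congr mxvec.
apply/matrixP => k j; rewrite summxE (bigD1 k) //= big1 ?addr0.
  by rewrite mxE big_ord1 !mxE !eqxx mul1r.
by move=> l nlk; rewrite mxE big_ord1 !mxE eq_sym (negbTE nlk) mul0r.
Qed.

Lemma eq_mx_inj_at d q (X Y : 'M[K]_(m * d, q)) :
  (forall l, inj_at d l *m X = inj_at d l *m Y) -> X = Y.
Proof.
move=> eqXY; rewrite -[X]mul1mx -[Y]mul1mx -sum_proj_inj !mulmx_suml.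
by apply: eq_bigr => l _; rewrite -!mulmxA eqXY.
Qed.

Lemma inj_sum_proj d q l (B : 'I_m -> 'M[K]_(d, q)) :
  inj_at d l *m (\sum_j proj_at d j *m B j) = B l.
Proof.
rewrite mulmx_sumr (bigD1 l) //= big1 ?addr0 => [|j nj].
  by rewrite mulmxA inj_proj eqxx mul1mx.
by rewrite mulmxA inj_proj eq_sym (negbTE nj) mul_scalar_mx scale0r.
Qed.

(* The free module A (x) K^d; the row block [inj_at d l] is 'b_l (x) K^d. *)
Definition freemod d : amod A := AMod (m * d) (fun a =>
  \sum_j proj_at d j *m (\sum_k coord (abasis A) k (a * 'b_j) *: inj_at d k)).

Lemma inj_freemod d l (a : A) : inj_at d l *m mact (freemod d) a =
  \sum_k coord (abasis A) k (a * 'b_l) *: inj_at d k.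
Proof. exact: inj_sum_proj. Qed.

Lemma freemod_amod d : is_amod (freemod d).
Proof.
split=> [k a b|a b|]; apply: eq_mx_inj_at => l.
- rewrite mulmxDr -scalemxAr !inj_freemod scaler_sumr -big_split /=.
  apply: eq_bigr => j _.
  by rewrite scalerA -scalerDl mulrDl -scalerAl linearP.
- rewrite mulmxA !inj_freemod mulmx_suml.
  under [RHS]eq_bigr do rewrite -scalemxAl inj_freemod scaler_sumr.
  rewrite exchange_big /=; apply: eq_bigr => k _.
  rewrite -mulrA [in LHS](coord_abasis (b * _)) mulr_sumr linear_sum scaler_suml.
  by apply: eq_bigr => j _; rewrite -scalerAr linearZ scalerA.
- rewrite inj_freemod mulmx1 mul1r (bigD1 l) //= coord_abasis_basis eqxx scale1r.
  by rewrite big1 ?addr0 // => j nj; rewrite coord_abasis_basis (negbTE nj) scale0r.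
Qed.

(** The A-linear extension a (x) v |-> a . phi(v), from the adjunction Hom_K(K^d, N) = Hom_A(A (x)
    K^d, N). *)
Definition free_ext N d (phi : 'M[K]_(d, mdim N)) : 'M[K]_(m * d, mdim N) :=
  \sum_j proj_at d j *m (phi *m mact N 'b_j).

Lemma inj_free_ext N d (phi : 'M[K]_(d, mdim N)) l :
  inj_at d l *m free_ext phi = phi *m mact N 'b_l.
Proof. exact: inj_sum_proj. Qed.

Lemma free_ext_hom N d (phi : 'M[K]_(d, mdim N)) : is_amod N ->
  @is_hom _ _ (freemod d) N (free_ext phi).
Proof.
move=> NN a; apply: eq_mx_inj_at => l; rewrite !mulmxA inj_freemod inj_free_ext.
rewrite mulmx_suml -mulmxA; case: (NN) => _ <- _.
rewrite (mact_coord _ NN) mulmx_sumr; apply: eq_bigr => j _.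
by rewrite -scalemxAl inj_free_ext -scalemxAr.
Qed.

(** The K-linear map v |-> 1 (x) v; the chosen basis may not contain 1, hence the coordinates. *)
Definition free_unit d : 'M[K]_(d, m * d) :=
  \sum_j coord (abasis A) j 1 *: inj_at d j.

Lemma free_unit_act d (a : A) : free_unit d *m mact (freemod d) a =
  \sum_j coord (abasis A) j a *: inj_at d j.
Proof.
rewrite mulmx_suml; under eq_bigr do rewrite -scalemxAl inj_freemod scaler_sumr.
rewrite exchange_big /=; apply: eq_bigr => k _.
rewrite -[in RHS](mulr1 a) [in RHS](coord_abasis 1) mulr_sumr linear_sum scaler_suml.
by apply: eq_bigr => j _; rewrite -scalerAr [in RHS]linearZ scalerA.
Qed.

Lemma free_unit_basis d l : free_unit d *m mact (freemod d) 'b_l = inj_at d l.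
Proof.
rewrite free_unit_act (bigD1 l) //= coord_abasis_basis eqxx scale1r.
by rewrite big1 ?addr0 // => j nj; rewrite coord_abasis_basis (negbTE nj) scale0r.
Qed.

Lemma free_unit_ext N d (phi : 'M[K]_(d, mdim N)) : is_amod N ->
  free_unit d *m free_ext phi = phi.
Proof.
move=> NN; rewrite mulmx_suml.
under eq_bigr do rewrite -scalemxAl inj_free_ext scalemxAr.
by rewrite -mulmx_sumr -mact_coord //; case: NN => _ _ ->; rewrite mulmx1.
Qed.

(** The images of the generators 1 (x) v are lifted through [p] by the K-linear section [pinvmx p],
    and this lift is extended A-linearly. *)
Lemma freemod_projective d : projective (freemod d).
Proof.
move=> N N' p f NN NN' hp fullp hf.
exists (free_ext (free_unit d *m f *m pinvmx p)); split; first exact: free_ext_hom.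
apply: eq_mx_inj_at => l; rewrite mulmxA inj_free_ext -mulmxA hp mulmxA mulmxKpV //.
  by rewrite -mulmxA -hf mulmxA free_unit_basis.
by rewrite (submx_full _ fullp).
Qed.

End FreeModules.

Arguments inj_at {K A} d l.
Arguments proj_at {K A} d l.
Arguments freemod {K} A d.
Arguments free_unit {K} A d.

(** * The bar complex *)

Section BarComplex.
Variables (K : fieldType) (A : falgType K).
Notation m := (\dim (fullv : {vspace A})).
Notation "''b_' i" := (tnth (abasis A) i) (at level 8, i at level 2).
Implicit Types M N : amod A.

Lemma bar_diff_linear M N n : linear (@bar_diff K A M N n).
Proof.
move=> a F G; apply/ffunP => t; rewrite !ffunE !scalerDr mulmxDl -scalemxAl.
rewrite mulmxDr scalerDr -scalemxAr !scalerA [a * _]mulrC.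
rewrite [RHS]addrACA; congr (_ + _); rewrite [RHS]addrACA; congr (_ + _).
rewrite scaler_sumr -big_split /=; apply: eq_bigr => k _.
rewrite scalerA mulrC -scalerA -scalerDr; congr (_ *: _).
rewrite scaler_sumr -big_split /=; apply: eq_bigr => j _.
by rewrite !ffunE scalerDr !scalerA mulrC.
Qed.

HB.instance Definition _ M N n :=
  GRing.isLinear.Build K (cochain M N n) (cochain M N n.+1) _ (@bar_diff K A M N n)
    (@bar_diff_linear M N n).

Definition pull M M' N n (f : 'M[K]_(mdim M', mdim M)) (F : cochain M N n) :
  cochain M' N n := [ffun t => f *m F t].

Lemma pull_linear M M' N n f : linear (@pull M M' N n f).
Proof.
by move=> a F G; apply/ffunP => t; rewrite !ffunE mulmxDr -scalemxAr.
Qed.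

HB.instance Definition _ M M' N n f :=
  GRing.isLinear.Build K (cochain M N n) (cochain M' N n) _ (@pull M M' N n f)
    (@pull_linear M M' N n f).

Lemma bar_diff_pull M M' N n (f : 'M[K]_(mdim M', mdim M)) (F : cochain M N n) :
  is_hom f -> bar_diff (pull f F) = pull f (bar_diff F).
Proof.
move=> hf; apply/ffunP => t; rewrite !ffunE !mulmxDr -scalemxAr !mulmxA hf.
congr (_ + _ + _); rewrite mulmx_sumr; apply: eq_bigr => k _.
rewrite -scalemxAr mulmx_sumr; congr (_ *: _); apply: eq_bigr => j _.
by rewrite ffunE scalemxAr.
Qed.

(** * Splitting off the last entry of a tuple, and currying the bar complex *)

Definition tup_snoc n (t : n.-tuple 'I_m) (l : 'I_m) : n.+1.-tuple 'I_m :=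
  [tuple of rcons t l].

Lemma tnth_snoc_widen n (t : n.-tuple 'I_m) l i :
  tnth (tup_snoc t l) (widen_ord (leqnSn n) i) = tnth t i.
Proof. by rewrite !(tnth_nth l) /= nth_rcons size_tuple ltn_ord. Qed.

Lemma tnth_snoc_max n (t : n.-tuple 'I_m) l : tnth (tup_snoc t l) ord_max = l.
Proof. by rewrite (tnth_nth l) /= nth_rcons size_tuple ltnn eqxx. Qed.

Lemma widen_ord_exists n (i : 'I_n.+1) :
  i != ord_max -> exists i' : 'I_n, i = widen_ord (leqnSn n) i'.
Proof.
move=> ni; have lti : (i < n)%N.
  by rewrite ltn_neqAle -ltnS ltn_ord andbT; apply: contra ni => /eqP ei; apply/eqP/val_inj.
by exists (Ordinal lti); apply: val_inj.
Qed.

Lemma tup_snoc_exists n (u : n.+1.-tuple 'I_m) :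
  exists (t : n.-tuple 'I_m) l, u = tup_snoc t l.
Proof.
exists (tup_front u), (tnth u ord_max); apply: eq_from_tnth => i.
have [->|ni] := eqVneq i ord_max; first by rewrite tnth_snoc_max.
have [i' ->] := widen_ord_exists ni.
by rewrite tnth_snoc_widen tnth_mktuple.
Qed.

Lemma tup_front_snoc n (t : n.-tuple 'I_m) l : tup_front (tup_snoc t l) = t.
Proof. by apply: eq_from_tnth => i; rewrite tnth_mktuple tnth_snoc_widen. Qed.

Lemma tup_tail_snoc n (t : n.+1.-tuple 'I_m) l :
  tup_tail (tup_snoc t l) = tup_snoc (tup_tail t) l.
Proof.
apply: eq_from_tnth => i; rewrite tnth_mktuple !(tnth_nth l) /= nth_rcons size_tuple.
rewrite /bump leq0n add1n ltnS nth_rcons size_map size_enum_ord.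
case: ltnP => [lti|lei]; last first.
  by rewrite eqSS.
by rewrite (nth_map (Ordinal lti)) ?size_enum_ord // (tnth_nth l) /= nth_enum_ord.
Qed.

Lemma tup_merge_snoc n (t : n.+1.-tuple 'I_m) l (k : 'I_n) j :
  tup_merge (tup_snoc t l) (widen_ord (leqnSn n) k) j = tup_snoc (tup_merge t k j) l.
Proof.
apply: eq_from_tnth => i; rewrite tnth_mktuple.
have [->|ni] := eqVneq i ord_max.
  rewrite tnth_snoc_max /= ltnNge (ltnW (ltn_ord k)) /=.
  rewrite -val_eqE /= gtn_eqF ?ltn_ord //.
  by rewrite -[RHS](tnth_snoc_max t l); congr (tnth _ _); apply: val_inj.
have [i' ->] := widen_ord_exists ni.
rewrite !tnth_snoc_widen tnth_mktuple /= -!val_eqE /=.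
case: ifP => // _; case: ifP => // _.
by rewrite -[RHS](tnth_snoc_widen t l); congr (tnth _ _); apply: val_inj.
Qed.

Lemma tup_merge_snoc_max n (t : n.+1.-tuple 'I_m) l j :
  tup_merge (tup_snoc t l) ord_max j = tup_snoc (tup_front t) j.
Proof.
apply: eq_from_tnth => i; rewrite tnth_mktuple.
have [->|ni] := eqVneq i ord_max; first by rewrite tnth_snoc_max /= ltnn.
have [i' ->] := widen_ord_exists ni.
by rewrite !tnth_snoc_widen tnth_mktuple /= ltn_ord.
Qed.

(* Absorbs the last tensor factor: C^(n+1)(M, N) = C^n(A (x) M, N), where A (x) M
   is free. *)
Definition bar_curry M N n (F : cochain M N n.+1) : cochain (freemod A (mdim M)) N n :=
  [ffun t => \sum_j proj_at (mdim M) j *m F (tup_snoc t j)].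

Lemma inj_bar_curry M N n (F : cochain M N n.+1) t l :
  inj_at (mdim M) l *m bar_curry F t = F (tup_snoc t l).
Proof. by rewrite ffunE inj_sum_proj. Qed.

Lemma bar_curry_inj M N n : injective (@bar_curry M N n).
Proof.
move=> F G eqFG; apply/ffunP => u; have [t [l ->]] := tup_snoc_exists u.
by rewrite -!inj_bar_curry eqFG.
Qed.

Lemma bar_curry_linear M N n : linear (@bar_curry M N n).
Proof.
move=> a F G; apply/ffunP => t; apply: eq_mx_inj_at => l.
by rewrite inj_bar_curry !ffunE mulmxDr -scalemxAr !inj_sum_proj.
Qed.

HB.instance Definition _ M N n :=
  GRing.isLinear.Build K (cochain M N n.+1) (cochain (freemod A (mdim M)) N n) _
    (@bar_curry M N n) (@bar_curry_linear M N n).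

(** The action map a (x) v |-> a . v from A (x) M onto M. *)
Definition free_mul M : 'M[K]_(m * mdim M, mdim M) := free_ext (N := M) 1%:M.

(** Merging the last two entries becomes the action of A on A (x) M, which is the last term of the
    differential there. Only the term acting on M is left over, with sign (-1)^(n+2) = (-1)^n. *)
Lemma bar_curry_diff M N n (F : cochain M N n.+1) :
  bar_curry (bar_diff F) =
  bar_diff (bar_curry F) + (-1) ^+ n *: pull (M' := freemod A (mdim M)) (free_mul M) F.
Proof.
apply/ffunP => t; apply: eq_mx_inj_at => l; rewrite inj_bar_curry.
rewrite [in RHS]ffunE mulmxDr !ffunE.
rewrite -scalemxAr [_ *m (free_mul M *m _)]mulmxA inj_free_ext mul1mx.
rewrite tnth_snoc_max tup_front_snoc !exprS !mulN1r opprK; congr (_ + _).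
rewrite !mulmxDr -addrA; congr (_ + _).
  rewrite tup_tail_snoc mulmxA inj_sum_proj; congr (_ *m mact N _).
  by rewrite !(tnth_nth l) /= nth_rcons size_tuple ltn0Sn.
rewrite big_ord_recr /=; congr (_ + _).
  rewrite mulmx_sumr; apply: eq_bigr => k _; rewrite -scalemxAr; congr (_ *: _).
  rewrite mulmx_sumr; apply: eq_bigr => j _.
  rewrite -scalemxAr inj_bar_curry tup_merge_snoc tnth_snoc_widen.
  congr (coord _ _ (_ * _) *: _); rewrite -[in RHS](tnth_snoc_widen t l).
  by congr tnth; congr tnth; apply: val_inj.
rewrite -scalemxAr exprS mulN1r; congr (_ *: _).
rewrite mulmxA inj_freemod mulmx_suml; apply: eq_bigr => j _.
rewrite -scalemxAl inj_sum_proj.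
rewrite tup_merge_snoc_max; congr (coord _ _ (_ * _) *: _).
  by rewrite tnth_snoc_widen.
by rewrite -[in RHS](tnth_snoc_max t l); congr tnth; congr tnth; apply: val_inj.
Qed.

Lemma bar_diff0 M N (F : cochain M N 0) t : bar_diff F t =
  F [tuple] *m mact N 'b_(tnth t ord0) - mact M 'b_(tnth t ord0) *m F [tuple].
Proof.
rewrite !ffunE big_ord0 addr0 expr1 scaleN1r (tuple0 (tup_tail t)) (tuple0 (tup_front t)).
by congr (_ - mact M 'b_(tnth t _) *m _); apply: val_inj.
Qed.

Lemma bar_diff_hom M N (f : 'M[K]_(mdim M, mdim N)) :
  is_hom f -> bar_diff (n := 0) (M := M) (N := N) [ffun _ => f] = 0.
Proof. by move=> hf; apply/ffunP => t; rewrite bar_diff0 !ffunE hf subrr. Qed.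

Lemma free_mul_hom M : is_amod M ->
  @is_hom _ _ (freemod A (mdim M)) M (free_mul M).
Proof. exact: free_ext_hom. Qed.

(** Induction on [n] with M generalized, since currying replaces M by A (x) M. In the step the two
    pullbacks along [free_mul] carry opposite signs and cancel. *)
Lemma bar_diff_bar_diff M N n (F : cochain M N n) : is_amod M -> is_amod N ->
  bar_diff (bar_diff F) = 0.
Proof.
move=> MM NN; elim: n M F MM => [|n IH] M F MM; apply: bar_curry_inj.
  rewrite bar_curry_diff expr0 scale1r linear0.
  (* The first summand is A-linear, hence a cocycle; the differential of the second cancels the
     remaining pullback. *)
  have -> : bar_curry (bar_diff F) =
      ([ffun _ => free_ext (F [tuple])] : cochain (freemod A (mdim M)) N 0)
      - pull (M' := freemod A (mdim M)) (free_mul M) F.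
    apply/ffunP => t; apply: eq_mx_inj_at => l.
    rewrite inj_bar_curry bar_diff0 !ffunE mulmxBr inj_free_ext mulmxA inj_free_ext mul1mx.
    by rewrite (tuple0 t) (tnth_nth l).
  rewrite linearB /= bar_diff_hom; last exact: free_ext_hom.
  by rewrite bar_diff_pull ?sub0r ?addNr //; exact: free_mul_hom.
rewrite bar_curry_diff bar_curry_diff linearD linearZ /= linear0.
rewrite (IH (freemod A (mdim M))); last exact: freemod_amod.
rewrite bar_diff_pull; last exact: free_mul_hom.
by rewrite add0r exprS mulN1r scaleNr subrr.
Qed.

(* A section [s] of [A (x) P -> P] yields the contracting homotopy
   [F |-> pull s (bar_curry F)]. *)
Lemma bar_acyclic P N n (F : cochain P N n.+1) : is_amod P -> projective P ->
  is_amod N -> bar_diff F = 0 -> exists G, F = bar_diff G.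
Proof.
move=> PP projP NN dF.
have full_mul : row_full (free_mul P).
  by apply/row_fullP; exists (free_unit A (mdim P)); exact: free_unit_ext.
have [//|s [hs smul]] := projP (freemod A (mdim P)) P (free_mul P) 1%:M
  (freemod_amod _ _) PP (free_mul_hom PP) full_mul.
  by move=> a; rewrite mulmx1 mul1mx.
pose G : cochain P N n := pull (M := freemod A (mdim P)) s (bar_curry F).
exists ((-1) ^+ n.+1 *: G); rewrite linearZ /= /G bar_diff_pull //.
have /eqP := bar_curry_diff F; rewrite dF linear0 eq_sym addr_eq0 => /eqP ->.
rewrite linearN linearZ /= -scaleN1r !scalerA -exprSr -exprD -signr_odd.
rewrite oddD /= negbK addbb expr0 scale1r; apply/ffunP => t.
by rewrite !ffunE mulmxA smul mul1mx.
Qed.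

End BarComplex.

(** * Exact sequences and Euler characteristics *)

Section ExactSequences.
Variables (K : fieldType) (A : falgType K).
Notation m := (\dim (fullv : {vspace A})).
Notation "''b_' i" := (tnth (abasis A) i) (at level 8, i at level 2).
Implicit Types M N P : amod A.

(* The dimension count replaces exactness in the middle. *)
Definition short_exact M' M M'' (i : 'M[K]_(mdim M', mdim M))
    (p : 'M[K]_(mdim M, mdim M'')) : Prop :=
  [/\ is_hom i, is_hom p, row_free i, row_full p &
      i *m p = 0 /\ mdim M = (mdim M' + mdim M'')%N].

(** The image of [i] lies in the kernel of [p], and the dimension count makes them equal. *)
Lemma short_exact_ker M' M M'' (i : 'M[K]_(mdim M', mdim M))
    (p : 'M[K]_(mdim M, mdim M'')) : short_exact i p -> (i :=: kermx p)%MS.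
Proof.
case=> _ _ /eqP ri /eqP rp [ip dimM]; apply/eqmxP.
have le : (i <= kermx p)%MS by apply/sub_kermxP.
by rewrite -(geq_leqif (mxrank_leqif_eq le)) mxrank_ker ri rp dimM addnK.
Qed.

Lemma ker_factor M' M M'' (i : 'M[K]_(mdim M', mdim M))
    (p : 'M[K]_(mdim M, mdim M'')) q (f : 'M[K]_(q, mdim M)) :
  short_exact i p -> f *m p = 0 -> exists g, f = g *m i.
Proof. by move=> e fp; apply/submxP; rewrite (short_exact_ker e); apply/sub_kermxP. Qed.

(** The matrix [1%:M - p *m pinvmx p] is annihilated by [p], so it factors through [i]; as
    [i *m f = 0], its product with [f] vanishes. *)
Lemma coker_factor M' M M'' (i : 'M[K]_(mdim M', mdim M))
    (p : 'M[K]_(mdim M, mdim M'')) q (f : 'M[K]_(mdim M, q)) :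
  short_exact i p -> i *m f = 0 -> f = p *m (pinvmx p *m f).
Proof.
move=> e if0; have [_ _ _ fullp _] := e.
have [|g gE] := @ker_factor _ _ _ _ _ _ (1%:M - p *m pinvmx p) e.
  by rewrite mulmxBl mul1mx -mulmxA mulVpmx // mulmx1 subrr.
apply/eqP; rewrite -subr_eq0 mulmxA -{1}[f]mul1mx -mulmxBl gE -mulmxA if0.
by rewrite mulmx0.
Qed.

Lemma lker_linfun (U V : vectType K) (f : {linear U -> V}) u :
  (u \in lker (linfun f)) = (f u == 0).
Proof. by rewrite memv_ker lfunE. Qed.

Lemma memv_cap_lker (U V : vectType K) (f : {linear U -> V}) (W : {vspace U}) u :
  (u \in (W :&: lker (linfun f))%VS) = (u \in W) && (f u == 0).
Proof. by rewrite memv_cap lker_linfun. Qed.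

Lemma dim_limg_inj (U V : vectType K) (f : {linear U -> V}) (W : {vspace U}) :
  injective f -> \dim (linfun f @: W) = \dim W.
Proof.
move=> inj_f; apply/limg_dim_eq/eqP; rewrite -subv0; apply/subvP => u.
rewrite memv_cap_lker memv0 => /andP[_ /eqP fu0].
by rewrite -(inj_eq inj_f) fu0 linear0.
Qed.

(** * Hom spaces and exactness of Hom(P, -) *)

Section Homs.

Lemma hom_defect_linear M N : linear (@hom_defect K A M N).
Proof.
move=> a f g; apply/ffunP => i; rewrite !ffunE mulmxDr mulmxDl -scalemxAr -scalemxAl.
by rewrite scalerBr opprD addrACA.
Qed.

HB.instance Definition _ M N :=
  GRing.isLinear.Build K 'M[K]_(mdim M, mdim N) {ffun 'I_m -> 'M[K]_(mdim M, mdim N)} _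
    (@hom_defect K A M N) (@hom_defect_linear M N).

Lemma mem_homspace M N f : is_amod M -> is_amod N ->
  f \in homspace M N <-> is_hom f.
Proof.
move=> MM NN; rewrite lker_linfun; split => [/eqP hf0 a|hf].
  rewrite (mact_coord a MM) (mact_coord a NN) mulmx_suml mulmx_sumr.
  apply: eq_bigr => i _; rewrite -scalemxAl -scalemxAr; congr (_ *: _).
  by apply/eqP; rewrite -subr_eq0; move/ffunP/(_ i): hf0; rewrite !ffunE => ->.
by apply/eqP/ffunP => i; rewrite !ffunE hf subrr.
Qed.

(** Rank-nullity for f |-> f p on Hom(P, M): the kernel is Hom(P, M') by left exactness, and the
    image is all of Hom(P, M'') by projectivity. *)
Lemma homdim_projective_add P M' M M'' (i : 'M[K]_(mdim M', mdim M))
    (p : 'M[K]_(mdim M, mdim M'')) :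
  is_amod P -> is_amod M' -> is_amod M -> is_amod M'' -> projective P ->
  short_exact i p -> homdim P M = (homdim P M' + homdim P M'')%N.
Proof.
move=> PP MM' MM MM'' projP e; have [hi hp freei fullp [ip dimM]] := e.
pose post : {linear 'M[K]_(mdim P, mdim M) -> 'M[K]_(mdim P, mdim M'')} := mulmxr p.
pose pre : {linear 'M[K]_(mdim P, mdim M') -> 'M[K]_(mdim P, mdim M)} := mulmxr i.
rewrite /homdim -(limg_ker_dim (linfun post)); congr (_ + _)%N.
  rewrite -[RHS](dim_limg_inj (f := pre)); last exact: row_free_inj.
  congr (\dim _); apply/eqP; rewrite eqEsubv; apply/andP; split; apply/subvP => f.
    rewrite memv_cap_lker /= => /andP[/mem_homspace hf /eqP fp].
    have [g fE] := ker_factor e fp.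
    apply/memv_imgP; exists g; last by rewrite lfunE.
    apply/mem_homspace => // a; apply: (row_free_inj freei).
    by rewrite /= -!mulmxA hi [g *m (i *m _)]mulmxA -fE hf.
  case/memv_imgP => g /mem_homspace hg ->; rewrite lfunE memv_cap_lker /=.
  rewrite -mulmxA ip mulmx0 eqxx andbT; apply/mem_homspace => // a.
  by rewrite mulmxA hg // -!mulmxA hi.
congr (\dim _); apply/eqP; rewrite eqEsubv; apply/andP; split; apply/subvP => f.
  case/memv_imgP => g /mem_homspace hg ->; rewrite lfunE; apply/mem_homspace => // a /=.
  by rewrite mulmxA hg // -!mulmxA hp.
move/mem_homspace => hf; have [//|//|//|//|//|g [hg gp]] := projP M M'' p f.
  exact: hf.
by apply/memv_imgP; exists g; [apply/mem_homspace|rewrite lfunE].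
Qed.

End Homs.

(** * Ranks in the bar complex and additivity of chi *)

Section Ext.

Definition bar_rank M N n := \dim (limg (linfun (@bar_diff K A M N n))).
Definition bar_nullity M N n := \dim (lker (linfun (@bar_diff K A M N n))).

Lemma bar_nullity_rank M N n :
  (bar_nullity M N n + bar_rank M N n = m ^ n * (mdim M * mdim N))%N.
Proof.
have := limg_ker_dim (linfun (@bar_diff K A M N n)) fullv.
by rewrite capfv => ->; rewrite dimvf /dim /= card_tuple card_ord.
Qed.

Lemma bar_rank_le_nullity M N n : is_amod M -> is_amod N ->
  (bar_rank M N n <= bar_nullity M N n.+1)%N.
Proof.
move=> MM NN; apply: dimvS; apply/subvP => _ /memv_imgP [F _ ->].
by rewrite lker_linfun lfunE /= bar_diff_bar_diff.
Qed.

Lemma extdim0 M N : extdim M N 0 = bar_nullity M N 0. Proof. by []. Qed.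

Lemma extdimS M N n : is_amod M -> is_amod N ->
  (extdim M N n.+1 + bar_rank M N n = bar_nullity M N n.+1)%N.
Proof. by move=> MM NN; rewrite subnK // bar_rank_le_nullity. Qed.

(** Restriction along [i] sends cocycles to cocycles, and a cocycle that it kills comes from a
    cochain on M'', which is a cocycle because [p] is surjective. *)
Lemma bar_nullity_subadd N M' M M'' (i : 'M[K]_(mdim M', mdim M))
    (p : 'M[K]_(mdim M, mdim M'')) n :
  short_exact i p ->
  (bar_nullity M N n <= bar_nullity M' N n + bar_nullity M'' N n)%N.
Proof.
move=> e; have [hi hp freei fullp [ip dimM]] := e.
pose pi : {linear cochain M N n -> cochain M' N n} := @pull K A M M' N n i.
pose pp : {linear cochain M'' N n -> cochain M N n} := @pull K A M'' M N n p.
rewrite [X in (X <= _)%N]/bar_nullity -(limg_ker_dim (linfun pi)) addnC.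
apply: leq_add.
  apply: dimvS; apply/subvP => _ /memv_imgP [F + ->].
  by rewrite !lker_linfun lfunE /= bar_diff_pull // => /eqP ->; rewrite linear0.
rewrite [X in (_ <= X)%N]/bar_nullity -(dim_limg_inj (f := pp)); last first.
  move=> F G /ffunP eqFG; apply/ffunP => t; apply: (row_full_inj fullp).
  by have := eqFG t; rewrite !ffunE.
apply: dimvS; apply/subvP => F; rewrite memv_cap_lker lker_linfun /=.
move=> /andP[/eqP dF /eqP /ffunP iF].
have FE : F = pp [ffun t => pinvmx p *m F t].
  by apply/ffunP => t; rewrite !ffunE; apply: coker_factor e _; have := iF t; rewrite !ffunE.
apply/memv_imgP; exists [ffun t => pinvmx p *m F t]; last by rewrite lfunE.
rewrite lker_linfun /=; apply/eqP/ffunP => t; apply: (row_full_inj fullp).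
move: dF; rewrite [in X in X -> _]FE /= bar_diff_pull // => /ffunP/(_ t).
by rewrite !ffunE mulmx0.
Qed.

(** The truncation to degrees below [n]; it equals chi(M, N) once Ext vanishes from degree [n]
    on. *)
Definition euler M N n : rat := \sum_(k < n) (-1) ^+ k * (extdim M N k)%:R.

Definition ext_vanish n0 M N := forall n, (n0 <= n)%N -> extdim M N n = 0%N.

Lemma euler_stable n0 n M N : ext_vanish n0 M N -> (n0 <= n)%N ->
  euler M N n = euler M N n0.
Proof.
move=> van /subnKC <-; elim: (n - n0)%N => [|k IH]; first by rewrite addn0.
by rewrite addnS /euler big_ord_recr /= van ?leq_addr // mulr0 addr0.
Qed.

(** Telescoping: dim Ext^k is dim C^k minus the ranks of the differentials leaving and entering C^k,
    so only the last rank survives. *)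
Lemma euler_rank M N n : is_amod M -> is_amod N -> euler M N n.+1 =
  \sum_(k < n.+1) (-1) ^+ k * (m ^ k * (mdim M * mdim N))%:R
    - (-1) ^+ n * (bar_rank M N n)%:R.
Proof.
move=> MM NN; elim: n => [|n IH].
  rewrite /euler !big_ord1 extdim0 -bar_nullity_rank natrD mulrDr addrK //.
rewrite /euler big_ord_recr /= -/(euler M N n.+1) IH [in RHS]big_ord_recr /=.
have := bar_nullity_rank M N n.+1; rewrite -extdimS // => <-.
by rewrite !natrD exprS; ring.
Qed.

Lemma euler_add n0 N M' M M'' (i : 'M[K]_(mdim M', mdim M))
    (p : 'M[K]_(mdim M, mdim M'')) :
  is_amod N -> is_amod M' -> is_amod M -> is_amod M'' -> short_exact i p ->
  ext_vanish n0 M' N -> ext_vanish n0 M N -> ext_vanish n0 M'' N ->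
  euler M N n0 = euler M' N n0 + euler M'' N n0.
Proof.
move=> NN MM' MM MM'' e van' van van''.
have [hi hp freei fullp [ip dimM]] := e.
(* The defect of additivity of [bar_rank] is nonnegative in every degree, and
   changes sign from one degree to the next once Ext vanishes. *)
have rank_add : bar_rank M N n0 = (bar_rank M' N n0 + bar_rank M'' N n0)%N.
  have n1 := leqnSn n0.
  have := extdimS n0 MM' NN; have := extdimS n0 MM NN; have := extdimS n0 MM'' NN.
  rewrite (van' _ n1) (van _ n1) (van'' _ n1).
  have := bar_nullity_rank M N n0; have := bar_nullity_rank M' N n0.
  have := bar_nullity_rank M'' N n0; have := bar_nullity_rank M N n0.+1.
  have := bar_nullity_rank M' N n0.+1; have := bar_nullity_rank M'' N n0.+1.
  have := bar_nullity_subadd N n0 e; have := bar_nullity_subadd N n0.+1 e.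
  rewrite dimM !mulnDl !mulnDr; lia.
(* The cutoff moves from n0 to n0 + 1, where the telescoped sum involves exactly the rank in degree
   n0. *)
rewrite -!(euler_stable _ (leqnSn n0)) // !euler_rank // rank_add dimM natrD.
rewrite (eq_bigr (fun k : 'I_n0.+1 => (-1) ^+ k * (m ^ k * (mdim M' * mdim N))%:R +
   (-1) ^+ k * (m ^ k * (mdim M'' * mdim N))%:R)) ?big_split /=; first by ring.
by move=> k _; rewrite mulnDl mulnDr natrD mulrDr.
Qed.

Definition const_cochain M N (f : 'M[K]_(mdim M, mdim N)) : cochain M N 0 :=
  [ffun _ => f].

Lemma const_cochain_linear M N : linear (@const_cochain M N).
Proof. by move=> a f g; apply/ffunP => t; rewrite !ffunE. Qed.

HB.instance Definition _ M N :=
  GRing.isLinear.Build K 'M[K]_(mdim M, mdim N) (cochain M N 0) _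
    (@const_cochain M N) (@const_cochain_linear M N).

(** A 0-cochain is a single matrix, and on it the bar differential is [hom_defect] up to sign. *)
Lemma extdim0_homdim M N : extdim M N 0 = homdim M N.
Proof.
rewrite /homdim -(dim_limg_inj (f := @const_cochain M N)); last first.
  by move=> f g /ffunP/(_ [tuple]); rewrite !ffunE.
congr (\dim _); apply/eqP; rewrite eqEsubv; apply/andP; split; apply/subvP => F.
  rewrite lker_linfun /= => /eqP dF.
  have FE : F = const_cochain (F [tuple]) by apply/ffunP => t; rewrite ffunE (tuple0 t).
  apply/memv_imgP; exists (F [tuple]); last by rewrite lfunE.
  rewrite lker_linfun; apply/eqP/ffunP => i; rewrite !ffunE.
  move/ffunP/(_ [tuple i]): dF; rewrite bar_diff0 !ffunE => /eqP.
  by rewrite subr_eq0 => /eqP ->; rewrite subrr.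
case/memv_imgP => f; rewrite lker_linfun => /eqP hf ->; rewrite lfunE lker_linfun /=.
apply/eqP/ffunP => t; rewrite bar_diff0 !ffunE.
by move/ffunP/(_ (tnth t ord0)): hf; rewrite !ffunE => hf; rewrite -opprB hf oppr0.
Qed.

Lemma extdim_projective P N n : is_amod P -> projective P -> is_amod N ->
  extdim P N n.+1 = 0%N.
Proof.
move=> PP projP NN; apply/eqP; rewrite subn_eq0; apply: dimvS; apply/subvP => F.
rewrite lker_linfun /= => /eqP /(bar_acyclic PP projP NN) [G ->].
by apply/memv_imgP; exists G; rewrite ?memvf ?lfunE.
Qed.

Lemma euler_projective P N n : is_amod P -> projective P -> is_amod N ->
  euler P N n.+1 = (homdim P N)%:R.
Proof.
move=> PP projP NN; rewrite /euler big_ord_recl expr0 mul1r extdim0_homdim.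
by rewrite big1 ?addr0 // => k _; rewrite extdim_projective ?mulr0.
Qed.

End Ext.

End ExactSequences.

(** * Submodules, quotients and composition series *)

Section Subquotients.
Variables (K : fieldType) (A : falgType K).
Implicit Types M N P : amod A.

Lemma is_hom_comp M N P (f : 'M[K]_(mdim M, mdim N)) (g : 'M[K]_(mdim N, mdim P)) :
  is_hom f -> is_hom g -> @is_hom K A M P (f *m g).
Proof. by move=> hf hg a; rewrite mulmxA hf -!mulmxA hg. Qed.

Lemma is_hom0 M N : @is_hom K A M N 0.
Proof. by move=> a; rewrite mulmx0 mul0mx. Qed.

Lemma is_hom1 M : @is_hom K A M M 1%:M.
Proof. by move=> a; rewrite mulmx1 mul1mx. Qed.

Definition invariant M q (U : 'M[K]_(q, mdim M)) := forall a, (U *m mact M a <= U)%MS.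

Lemma invariant_ker M N (f : 'M[K]_(mdim M, mdim N)) :
  is_hom f -> invariant (M := M) (kermx f).
Proof. by move=> hf a; apply/sub_kermxP; rewrite -mulmxA hf mulmxA mulmx_ker mul0mx. Qed.

Lemma invariant_hom M N (f : 'M[K]_(mdim M, mdim N)) :
  is_hom f -> invariant (M := N) f.
Proof. by move=> hf a; rewrite -hf submxMl. Qed.

(** The action is written in the basis [row_base U] of U; [pinvmx] reads off coordinates of vectors
    lying in U. *)
Definition submod M q (U : 'M[K]_(q, mdim M)) : amod A :=
  AMod (\rank U) (fun a => row_base U *m mact M a *m pinvmx (row_base U)).

Lemma submod_hom M q (U : 'M[K]_(q, mdim M)) :
  invariant U -> @is_hom K A (submod U) M (row_base U).
Proof.
move=> invU a; rewrite /= mulmxKpV //.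
rewrite (eqmxMr _ (eq_row_base U)) eq_row_base; exact: invU.
Qed.

Lemma sub_amod M N (f : 'M[K]_(mdim N, mdim M)) : is_amod M -> is_hom f -> row_free f ->
  (forall (k : K) (a b : A), mact N (k *: a + b) = k *: mact N a + mact N b) ->
  is_amod N.
Proof.
move=> [linM mulM unitM] hf freef linN; split=> // [a b|];
  apply: (row_free_inj freef) => /=.
  by rewrite hf mulM -[RHS]mulmxA hf [RHS]mulmxA hf mulmxA.
by rewrite hf unitM mulmx1 mul1mx.
Qed.

Lemma submod_amod M q (U : 'M[K]_(q, mdim M)) :
  is_amod M -> invariant U -> is_amod (submod U).
Proof.
move=> MM invU; apply: (sub_amod MM (submod_hom invU) (row_base_free _)) => k a b /=.
by case: MM => -> _ _; rewrite mulmxDr mulmxDl -scalemxAr -scalemxAl.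
Qed.

Lemma quot_amod M N (p : 'M[K]_(mdim M, mdim N)) : is_amod M -> is_hom p -> row_full p ->
  (forall (k : K) (a b : A), mact N (k *: a + b) = k *: mact N a + mact N b) ->
  is_amod N.
Proof.
move=> [linM mulM unitM] hp fullp linN; split=> // [a b|];
  apply: (row_full_inj fullp) => /=.
  by rewrite -hp mulM [RHS]mulmxA -hp -[RHS]mulmxA -hp mulmxA.
by rewrite -hp unitM mulmx1 mul1mx.
Qed.

(** The square matrix [cokermx U] has kernel U; its column base keeps this kernel and has full
    column rank, so it is a projection onto M/U. *)
Definition quot_proj M q (U : 'M[K]_(q, mdim M)) : 'M[K]_(mdim M, \rank (cokermx U)) :=
  col_base (cokermx U).

Definition quotmod M q (U : 'M[K]_(q, mdim M)) : amod A :=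
  AMod (\rank (cokermx U)) (fun a => pinvmx (quot_proj U) *m mact M a *m quot_proj U).

Lemma quot_proj_ker M q (U : 'M[K]_(q, mdim M)) r (X : 'M[K]_(r, mdim M)) :
  (X *m quot_proj U == 0) = (X <= U)%MS.
Proof.
rewrite submxE -[in RHS](mulmx_base (cokermx U)) mulmxA.
apply/eqP/eqP => [-> | XU0]; first by rewrite mul0mx.
by apply: (row_free_inj (row_base_free (cokermx U))); rewrite /= mul0mx.
Qed.

Lemma quot_proj_hom M q (U : 'M[K]_(q, mdim M)) :
  invariant U -> @is_hom K A M (quotmod U) (quot_proj U).
Proof.
move=> invU a; apply/eqP; rewrite -subr_eq0 [X in _ - X]mulmxA -mulmxBl quot_proj_ker /=.
rewrite [quot_proj U *m (_ *m _)]mulmxA -[X in (X - _ <= _)%MS]mul1mx -mulmxBl.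
apply: submx_trans (invU a); apply: submxMr; rewrite -quot_proj_ker mulmxBl mul1mx.
by rewrite -mulmxA mulVpmx ?mulmx1 ?subrr // col_base_full.
Qed.

Lemma quotmod_amod M q (U : 'M[K]_(q, mdim M)) :
  is_amod M -> invariant U -> is_amod (quotmod U).
Proof.
move=> MM invU; apply: (quot_amod MM (quot_proj_hom invU) (col_base_full _)) => k a b /=.
by case: MM => -> _ _; rewrite mulmxDr mulmxDl -scalemxAr -scalemxAl.
Qed.

Lemma sub_quot_exact M q (U : 'M[K]_(q, mdim M)) : invariant U ->
  @short_exact K A (submod U) M (quotmod U) (row_base U) (quot_proj U).
Proof.
move=> invU; split; [exact: submod_hom|exact: quot_proj_hom|exact: row_base_free|
  exact: col_base_full|split].
  by apply/eqP; rewrite quot_proj_ker eq_row_base.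
by rewrite /= mxrank_coker subnKC // rank_leq_col.
Qed.

Lemma factor_full q1 q2 q3 (q : 'M[K]_(q1, q2)) (p : 'M[K]_(q1, q3)) :
  row_full q -> kermx q *m p = 0 -> p = q *m (pinvmx q *m p).
Proof.
move=> fullq kp; apply/eqP; rewrite -subr_eq0 mulmxA -{1}[p]mul1mx -mulmxBl.
have /submxP [X ->] : (1%:M - q *m pinvmx q <= kermx q)%MS.
  by apply/sub_kermxP; rewrite mulmxBl mul1mx -mulmxA mulVpmx // mulmx1 subrr.
by rewrite -mulmxA kp mulmx0.
Qed.

Lemma nonsimple_invariant M : (0 < mdim M)%N -> ~ simple M ->
  exists U : 'M[K]_(mdim M), invariant U /\ (0 < \rank U < mdim M)%N.
Proof.
move=> M0 nsM; apply: contrapT => noU; apply: nsM; split=> // U invU.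
have [->|rU] := posnP (\rank U); first by left.
right; apply/eqP; rewrite eqn_leq rank_leq_row /= leqNgt; apply/negP => ltU.
by apply: noU; exists U; rewrite rU ltU.
Qed.

(** The image is a nonzero submodule of S; [<<f>>] presents it as the square matrix that [simple]
    expects. *)
Lemma hom_simple_full M S (f : 'M[K]_(mdim M, mdim S)) :
  simple S -> is_hom f -> f != 0 -> row_full f.
Proof.
move=> [_ simS] hf f0; have [a|rf|rf] := simS <<f>>%MS.
- rewrite (eqmxMr _ (genmxE f)) genmxE; exact: invariant_hom.
- by move: f0; rewrite -mxrank_eq0 -(genmxE f) => /eqP.
- by rewrite /row_full -[X in _ == X]rf genmxE.
Qed.

Lemma hom_simple_free S M (f : 'M[K]_(mdim S, mdim M)) :
  simple S -> is_hom f -> f != 0 -> row_free f.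
Proof.
move=> [_ simS] hf f0; have := simS _ (invariant_ker hf).
rewrite mxrank_ker /row_free -mxrank_eq0 in f0 * => -[/eqP|] H.
  by rewrite eqn_leq rank_leq_row.
by have := rank_leq_row f; have := f0; lia.
Qed.

Lemma bij_hom_iso M N (f : 'M[K]_(mdim M, mdim N)) :
  is_hom f -> row_free f -> row_full f -> iso M N.
Proof.
move=> hf freef fullf; exists f, (pinvmx f).
rewrite mulmxVp // mulVpmx //; split=> // a.
apply: (row_full_inj fullf); rewrite mulmxA -hf -mulmxA mulmxVp // mulmx1.
by rewrite mulmxA mulmxVp // mul1mx.
Qed.

Lemma iso_bij M N : iso M N ->
  exists f : 'M[K]_(mdim M, mdim N), [/\ is_hom f, row_free f & row_full f].
Proof.
by case=> f [g [hf hg fg gf]]; exists f; split=> //; [apply/row_freeP|apply/row_fullP]; exists g.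
Qed.

Lemma zero_mod_amod : is_amod (zero_mod A).
Proof. by split=> *; exact: thinmx0 || rewrite [LHS]thinmx0 [RHS]thinmx0. Qed.

Lemma dsum_amod M N : is_amod M -> is_amod N -> is_amod (dsum M N).
Proof.
move=> [linM mulM unitM] [linN mulN unitN]; split=> [k a b|a b|] /=.
- by rewrite linM linN scale_block_mx add_block_mx !scaler0 !addr0.
- by rewrite mulmx_block mulM mulN !mulmx0 !mul0mx !addr0 add0r.
- by rewrite unitM unitN -scalar_mx_block.
Qed.

Lemma dsum_exact M N : @short_exact K A M (dsum M N) N (row_mx 1%:M 0) (col_mx 0 1%:M).
Proof.
split=> [a|a|||].
- by rewrite /= mul_mx_row mul_row_block mulmx1 mulmx0 !mul1mx !mul0mx !addr0.
- by rewrite /= mul_block_col mul_col_mx !mulmx1 mulmx0 !mul1mx !mul0mx !add0r.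
- by apply/row_freeP; exists (col_mx 1%:M 0); rewrite mul_row_col mulmx1 mulmx0 addr0.
- by apply/row_fullP; exists (row_mx 0 1%:M); rewrite mul_row_col mulmx1 mulmx0 add0r.
- by rewrite mul_row_col mulmx0 mul0mx addr0.
Qed.

(** Such invariants factor through the Grothendieck group of A; the instances that matter are dim
    Hom(P, -) and chi(-, N). *)
Definition additive_fun (phi : amod A -> rat) : Prop :=
  forall M' M M'' (i : 'M[K]_(mdim M', mdim M)) (p : 'M[K]_(mdim M, mdim M'')),
  is_amod M' -> is_amod M -> is_amod M'' -> short_exact i p ->
  phi M = phi M' + phi M''.

(** With zero maps 0 -> M -> M -> M -> 0 is exact, whence phi(M) = 2 phi(M). *)
Lemma additive_fun0 phi M : additive_fun phi -> is_amod M -> mdim M = 0%N -> phi M = 0.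
Proof.
move=> addphi MM M0; have := addphi M M M 0 0 MM MM MM.
rewrite -{1}[phi M]addr0 => H; apply/esym/(addrI (phi M))/H.
split; rewrite ?mul0mx ?M0 //; try exact: is_hom0.
  by rewrite /row_free mxrank0.
by rewrite /row_full mxrank0.
Qed.

Lemma additive_fun_iso phi M N : additive_fun phi -> is_amod M -> is_amod N ->
  iso M N -> phi M = phi N.
Proof.
move=> addphi MM NN /iso_bij [f [hf freef fullf]].
have := addphi (zero_mod A) M N 0 f zero_mod_amod MM NN.
rewrite (additive_fun0 addphi zero_mod_amod) // add0r; apply.
split; rewrite ?mul0mx //; first exact: is_hom0.
  by rewrite /row_free mxrank0.
by split=> //=; rewrite add0n -(eqP freef) (eqP fullf).
Qed.

Lemma additive_fun_bigdsum phi (I : Type) (M : I -> amod A) (s : seq I) :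
  additive_fun phi -> (forall i, is_amod (M i)) ->
  is_amod (bigdsum [seq M i | i <- s]) /\
  phi (bigdsum [seq M i | i <- s]) = \sum_(i <- s) phi (M i).
Proof.
move=> addphi MM; elim: s => [|i s [IHm IH]] /=.
  by rewrite big_nil; split; [exact: zero_mod_amod|
    apply: additive_fun0 addphi zero_mod_amod _].
split; first exact: dsum_amod.
rewrite big_cons -IH; apply: addphi (dsum_exact _ _) => //; exact: dsum_amod.
Qed.

(** The list is chosen before [phi], so it records the class of M in the Grothendieck group.
    Induction on dimension: a nonsimple M is cut by a proper nonzero submodule, and the two lists
    are concatenated. *)
Lemma composition_series (I : Type) (S : I -> amod A) :
  (forall i, is_amod (S i)) ->
  (forall M, is_amod M -> simple M -> exists i, iso M (S i)) ->
  forall M, is_amod M -> exists s : seq I,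
    forall phi, additive_fun phi -> phi M = \sum_(i <- s) phi (S i).
Proof.
move=> SS S_all M; have [d] := ubnP (mdim M); elim: d M => // d IH M ltMd MM.
have [M0|M0] := posnP (mdim M).
  by exists [::] => phi addphi; rewrite big_nil; apply: additive_fun0.
have [simM|/nonsimple_invariant] := pselect (simple M).
  have [i isoMi] := S_all M MM simM; exists [:: i] => phi addphi.
  by rewrite big_seq1; apply: additive_fun_iso.
case=> // U [invU /andP[U0 UM]]; have UU := submod_amod MM invU.
have QQ := quotmod_amod MM invU.
have [|s Hs] := IH (submod U) _ UU; first by apply: leq_trans UM _; rewrite -ltnS.
have [|t Ht] := IH (quotmod U) _ QQ.
  by rewrite /= mxrank_coker; move: ltMd U0 M0; lia.
exists (s ++ t) => phi addphi; rewrite big_cat /= -Hs // -Ht //.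
exact: addphi UU MM QQ (sub_quot_exact invU).
Qed.

(** Induction on dimension: a nonsimple module is replaced by a proper nonzero quotient. *)
Lemma simple_quotient M : is_amod M -> (0 < mdim M)%N -> exists S (p : 'M[K]_(mdim M, mdim S)),
  [/\ is_amod S, simple S, is_hom p & row_full p].
Proof.
have [d] := ubnP (mdim M); elim: d M => // d IH M ltMd MM M0.
have [simM|/nonsimple_invariant] := pselect (simple M).
  by exists M, 1%:M; split=> //; [exact: is_hom1|rewrite row_full_unit unitmx1].
case=> // U [invU /andP[U0 UM]]; have QQ := quotmod_amod MM invU.
have [|||S [p [SS simS hp fullp]]] := IH (quotmod U).
- by rewrite /= mxrank_coker; move: ltMd U0 M0; lia.
- by [].
- by rewrite /= mxrank_coker subn_gt0.
exists S, (quot_proj U *m p); split=> //.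
  exact: is_hom_comp (quot_proj_hom invU) hp.
apply/row_fullP; exists (pinvmx p *m pinvmx (quot_proj U)).
rewrite mulmxA -[_ *m quot_proj U]mulmxA mulVpmx ?mulmx1 ?mulVpmx //.
exact: col_base_full.
Qed.

End Subquotients.

(** * Tops of indecomposable projective modules *)

Section Fitting.
Variables (K : fieldType) (A : falgType K).
Implicit Types M N P Q S T : amod A.

Lemma homdim_neq0P M N : is_amod M -> is_amod N ->
  homdim M N <> 0%N <-> exists f : 'M[K]_(mdim M, mdim N), is_hom f /\ f != 0.
Proof.
move=> MM NN; split => [hMN | [f [hf f0]] hMN].
  exists (vpick (homspace M N)); split; first by apply/mem_homspace/memv_pick.
  by rewrite vpick0; apply/eqP => h0; apply: hMN; rewrite /homdim h0 dimv0.
have /eqP := hMN; rewrite dimv_eq0 => /eqP h0; move: f0.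
have : f \in homspace M N by apply/mem_homspace.
by rewrite h0 memv0 => ->.
Qed.

Lemma is_hom_comm M (h : 'M[K]_(mdim M)) : is_hom h <-> forall a, comm_mx h (mact M a).
Proof. by split=> H a; have := H a. Qed.

(* Fitting: [char_poly h * 'X = c * 'X^m] with [c(0) <> 0], the extra factor ['X]
   making [m > 0]; a Bezout relation between [c] and ['X^m] gives an idempotent
   polynomial in [h]. *)
Lemma indecomposable_fix_unit M q (h : 'M[K]_(mdim M)) (p : 'M[K]_(mdim M, q)) :
  indecomposable M -> is_hom h -> h *m p = p -> p != 0 -> h \in unitmx.
Proof.
case: M h p => [[|d] act] h p [//= _ indM] hh hp p0.
have [k [c]] := multiplicity_XsubC (char_poly h * 'X) 0.
rewrite mulf_eq0 polyX_eq0 (negbTE (monic_neq0 (char_poly_monic h))) /= subr0 => c0 cE.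
case: k cE => [|k] cE.
  by move: c0; rewrite expr0 mulr1 in cE; rewrite -cE rootM rootX eqxx orbT.
have : coprimep c ('X^(k.+1)) by apply: coprimep_expr; rewrite -['X]subr0 -polyC0 coprimep_XsubC.
case/Bezout_eq1_coprimepP => u uE; pose e := horner_mx h (u.2 * 'X^(k.+1)).
have e1E : 1%:M - e = horner_mx h (u.1 * c).
  by rewrite -[1%:M](rmorph1 (horner_mx h)) -uE -rmorphB /= addrK.
have ee : e *m e = e.
  apply/eqP; rewrite -subr_eq0 -{3}[e]mulmx1 -mulmxBr -oppr_eq0 -mulmxN opprB e1E.
  rewrite -[_ *m _](rmorphM (horner_mx h)) /=.
  have -> : u.2 * 'X^(k.+1) * (u.1 * c) = u.2 * u.1 * 'X * char_poly h.
    by rewrite -[RHS]mulrA ['X * _]mulrC cE [c * _]mulrC mulrACA.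
  by rewrite rmorphM /= Cayley_Hamilton mulr0.
have he : @is_hom K A (AMod d.+1 act) (AMod d.+1 act) e.
  by apply/is_hom_comm => a; apply/comm_horner_mx; move/is_hom_comm: hh; apply.
have hXE j : horner_mx h 'X^j = h ^+ j by rewrite rmorphXn /= horner_mx_X.
(* If e = 0 then h^(k+1) = 0, against h p = p with p nonzero; if e = 1 then h is a factor of e in
   K[h], hence invertible. *)
case: (indM e he ee) => [e0|e1].
  have hk1 : h ^+ k.+1 = 0.
    have c1 : horner_mx h (u.1 * c) = 1 by rewrite -e1E e0 subr0.
    rewrite -[LHS]mulr1 -c1 -hXE -rmorphM mulrCA ['X^_ * c]mulrC -cE.
    by rewrite !rmorphM /= Cayley_Hamilton mul0r mulr0.
  have hpk j : h ^+ j *m p = p.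
    by elim: j => [|j IH]; [rewrite expr0 mul1mx|rewrite exprSr -mulmxA hp IH].
  by move: p0; rewrite -(hpk k.+1) hk1 mul0mx eqxx.
have : horner_mx h (u.2 * 'X^k) *m h = 1%:M.
  rewrite -[X in _ *m X]horner_mx_X -[_ *m _](rmorphM (horner_mx h)) /=.
  by rewrite -mulrA -exprSr.
by case/mulmx1_unit.
Qed.

(** Otherwise [p] maps the kernel of [q] onto S, and projectivity lifts [p] through that kernel. The
    resulting endomorphism of Q fixes [p], so it is invertible; but its image lies in the kernel of
    [q], forcing q = 0. *)
Lemma kermx_top_sub Q S T (p : 'M[K]_(mdim Q, mdim S)) (q : 'M[K]_(mdim Q, mdim T)) :
  is_amod Q -> is_amod S -> is_amod T -> indecomposable Q -> projective Q ->
  simple S -> is_hom p -> is_hom q -> q != 0 -> kermx q *m p = 0.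
Proof.
move=> QQ SS TT indQ projQ simS hp hq q0; apply/eqP/negPn/negP => kp0.
have invU := invariant_ker hq; set U := kermx q in invU kp0.
have hB := submod_hom invU; have UU := submod_amod QQ invU.
have Bp0 : row_base U *m p != 0.
  apply: contraNneq kp0 => Bp; have /submxP [X ->] : (U <= row_base U)%MS.
    by rewrite eq_row_base.
  by rewrite -mulmxA Bp mulmx0.
have hBp := is_hom_comp hB hp.
have [g [hg gE]] := projQ (submod U) S (row_base U *m p) p UU SS hBp
  (hom_simple_full simS hBp Bp0) hp.
have p0 : p != 0 by apply: contraNneq Bp0 => ->; rewrite mulmx0.
have uh : g *m row_base U \in unitmx.
  apply: indecomposable_fix_unit indQ _ _ p0; first exact: is_hom_comp hg hB.
  by rewrite -mulmxA.
move: q0; rewrite -[q](mulKmx uh) -mulmxA.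
have /sub_kermxP -> : (row_base U <= kermx q)%MS by rewrite eq_row_base.
by rewrite !mulmx0 eqxx.
Qed.

Lemma top_factor Q S T (p : 'M[K]_(mdim Q, mdim S)) (q : 'M[K]_(mdim Q, mdim T)) :
  is_amod Q -> is_amod S -> is_amod T -> indecomposable Q -> projective Q ->
  simple S -> simple T -> is_hom p -> is_hom q -> q != 0 ->
  exists f : 'M[K]_(mdim T, mdim S), is_hom f /\ p = q *m f.
Proof.
move=> QQ SS TT indQ projQ simS simT hp hq q0.
have fullq := hom_simple_full simT hq q0.
have pE := factor_full fullq (kermx_top_sub QQ SS TT indQ projQ simS hp hq q0).
exists (pinvmx q *m p); split=> // a; apply: (row_full_inj fullq).
by rewrite mulmxA -hq -mulmxA -pE hp mulmxA -pE.
Qed.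

Lemma top_unique Q S T : is_amod Q -> is_amod S -> is_amod T ->
  indecomposable Q -> projective Q -> simple S -> simple T ->
  homdim Q S <> 0%N -> homdim Q T <> 0%N -> iso T S.
Proof.
move=> QQ SS TT indQ projQ simS simT.
move=> /(homdim_neq0P QQ SS) [p [hp p0]] /(homdim_neq0P QQ TT) [q [hq q0]].
have [f [hf pE]] := top_factor QQ SS TT indQ projQ simS simT hp hq q0.
have f0 : f != 0 by apply: contraNneq p0 => f0; rewrite pE f0 mulmx0.
exact: bij_hom_iso hf (hom_simple_free simT hf f0) (hom_simple_full simS hf f0).
Qed.

(** Lifting the maps to S through each other gives g : Q -> R and h : R -> Q whose composites fix
    nonzero maps to S; both composites are then invertible. *)
Lemma proj_cover_unique Q R S : is_amod Q -> is_amod R -> is_amod S ->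
  indecomposable Q -> projective Q -> indecomposable R -> projective R -> simple S ->
  homdim Q S <> 0%N -> homdim R S <> 0%N -> iso Q R.
Proof.
move=> QQ RR SS indQ projQ indR projR simS.
move=> /(homdim_neq0P QQ SS) [p [hp p0]] /(homdim_neq0P RR SS) [q [hq q0]].
have [g [hg gE]] := projQ R S q p RR SS hq (hom_simple_full simS hq q0) hp.
have [h [hh hE]] := projR Q S p q QQ SS hp (hom_simple_full simS hp p0) hq.
have ugh : g *m h \in unitmx.
  apply: indecomposable_fix_unit indQ (is_hom_comp hg hh) _ p0.
  by rewrite -mulmxA hE gE.
have uhg : h *m g \in unitmx.
  apply: indecomposable_fix_unit indR (is_hom_comp hh hg) _ q0.
  by rewrite -mulmxA gE hE.
apply: bij_hom_iso hg _ _.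
  by apply/row_freeP; exists (h *m invmx (g *m h)); rewrite mulmxA mulmxV.
by apply/row_fullP; exists (invmx (h *m g) *m h); rewrite -mulmxA mulVmx.
Qed.

(** Induction on dimension: a decomposable M has a proper direct summand that still maps
    nontrivially to S. *)
Lemma proj_cover_exists M S : is_amod M -> projective M -> is_amod S ->
  homdim M S <> 0%N ->
  exists Q, [/\ is_amod Q, indecomposable Q, projective Q & homdim Q S <> 0%N].
Proof.
have [d] := ubnP (mdim M); elim: d M => // d IH M ltMd MM projM SS hMS.
have [indM|nindM] := pselect (indecomposable M); first by exists M.
have [f [hf f0]] := (homdim_neq0P MM SS).1 hMS.
have M0 : (0 < mdim M)%N.
  rewrite lt0n; apply: contra f0 => /eqP M0; apply/eqP/matrixP => i.
  by have := ltn_ord i; rewrite {2}M0.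
(* If a nontrivial idempotent e has e f = 0, its complement takes over, since (1 - e) f = f. *)
have [e [he ee e0 e1]] : exists e : 'M[K]_(mdim M),
    [/\ is_hom e, e *m e = e, e *m f != 0 & e != 1%:M].
  apply: contrapT => noe; apply: nindM; split=> // e he ee; apply: contrapT => ne.
  have [ef0|ef0] := eqVneq (e *m f) 0; last first.
    by apply: noe; exists e; split=> //; apply/eqP => e1; apply: ne; right.
  apply: noe; exists (1%:M - e); split.
  - by move=> a; rewrite mulmxBr mulmxBl mulmx1 mul1mx he.
  - by rewrite mulmxBl mul1mx mulmxBr mulmx1 ee subrr subr0.
  - by rewrite mulmxBl mul1mx ef0 subr0.
  - rewrite subr_eq addrC -subr_eq subrr eq_sym; apply/eqP => e0; apply: ne; left.
    exact: e0.
(* The image of [e] is a direct summand, with inclusion [row_base e] and retraction [col_base e]. *)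
have invU := invariant_hom he; have hB := submod_hom invU; have UU := submod_amod MM invU.
have Be : row_base e *m e = row_base e.
  by have /submxP [X ->] : (row_base e <= e)%MS; rewrite ?eq_row_base // -mulmxA ee.
have injB q (X Y : 'M[K]_(q, \rank e)) : X *m row_base e = Y *m row_base e -> X = Y.
  by move=> XY; apply: (row_free_inj (row_base_free e)).
have colE : col_base e *m row_base e = e := mulmx_base e.
have hC : @is_hom K A M (submod e) (col_base e).
  move=> a; apply: injB.
  by rewrite -[LHS]mulmxA colE -[RHS]mulmxA hB [RHS]mulmxA colE he.
have CB1 : row_base e *m col_base e = 1%:M.
  by apply: injB; rewrite -mulmxA colE Be mul1mx.
apply: (IH (submod e)) => //.
- apply: leq_trans (_ : (\rank e < mdim M)%N) _; last by rewrite -ltnS.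
  rewrite ltn_neqAle rank_leq_row andbT; apply: contra e1 => re.
  have ue : e \in unitmx by rewrite -row_free_unit.
  by rewrite -[e](mulKmx ue) ee mulVmx.
- move=> N N' p g NN NN' hp fullp hg.
  have [h [hh hE]] := projM N N' p (col_base e *m g) NN NN' hp fullp (is_hom_comp hC hg).
  exists (row_base e *m h); split; first exact: is_hom_comp hB hh.
  by rewrite -mulmxA hE mulmxA CB1 mul1mx.
- apply/(homdim_neq0P UU SS); exists (row_base e *m f); split; first exact: is_hom_comp hB hf.
  by apply: contraNneq e0 => Bf0; rewrite -colE -mulmxA Bf0 mulmx0.
Qed.

(** The map a |-> a . v is nonzero for any nonzero v, hence onto; the all-ones vector serves as
    v. *)
Lemma free1_simple_full S : is_amod S -> simple S ->
  exists p : 'M[K]_(mdim (freemod A 1), mdim S), is_hom p /\ row_full p.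
Proof.
move=> SS simS; have [S0 _] := simS.
pose v : 'rV[K]_(mdim S) := const_mx 1.
exists (free_ext (N := S) v); have hp := free_ext_hom v SS; split=> //.
apply: hom_simple_full simS hp _; apply/eqP => p0.
have := free_unit_ext v SS; rewrite p0 mulmx0 => /rowP/(_ (Ordinal S0)).
by rewrite !mxE => /esym/eqP; rewrite oner_eq0.
Qed.

End Fitting.

(** * Schur's lemma and multiplicity one of the top *)

Section AlgebraicallyClosed.
Variables (K : closedFieldType) (A : falgType K).
Implicit Types M N P Q S T : amod A.

Lemma schur S (f : 'M[K]_(mdim S)) : simple S -> is_hom f -> exists c, f = c%:M.
Proof.
move=> simS hf; have [S0 _] := simS.
have /closed_rootP [c] : size (char_poly f) != 1%N.
  by rewrite size_char_poly; move: S0; lia.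
rewrite -eigenvalue_root_char => /eigenvalueP [v vf v0]; exists c.
apply/eqP; rewrite -subr_eq0; apply/negPn/negP => fc0.
have hfc : @is_hom K A S S (f - c%:M).
  by move=> a; rewrite mulmxBr mulmxBl hf scalar_mxC.
have freefc := hom_simple_free simS hfc fc0; case/eqP: v0.
by apply: (row_free_inj freefc); rewrite /= mulmxBr vf mul_mx_scalar subrr mul0mx.
Qed.

(** Every map Q -> S factors through a fixed nonzero one by an endomorphism of S, which is a
    scalar. *)
Lemma homdim_top Q S : is_amod Q -> is_amod S -> indecomposable Q -> projective Q ->
  simple S -> homdim Q S <> 0%N -> homdim Q S = 1%N.
Proof.
move=> QQ SS indQ projQ simS /(homdim_neq0P QQ SS) [p [hp p0]].
have <- : \dim <[p]> = 1%N by rewrite dim_vline p0.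
congr (\dim _); apply/eqP; rewrite eqEsubv; apply/andP; split; apply/subvP => f; last first.
  by case/vlineP => c ->; apply/mem_homspace => // a; rewrite -scalemxAr hp scalemxAl.
move/mem_homspace => hf.
have [g [hg ->]] := top_factor QQ SS SS indQ projQ simS simS (hf QQ SS) hp p0.
by have [c ->] := schur simS hg; rewrite mul_mx_scalar; apply/vlineP; exists c.
Qed.

End AlgebraicallyClosed.

(** * The magnitude *)

(** The permutation fixes the all-ones column u, so Z^-1 u = (c^T)^-1 u; with u^T = x^T c^T this
    gives u^T Z^-1 u = x^T u. *)
Lemma magnitude_factor n (s : {perm 'I_n}) (Z c E : 'M[rat]_n) (x : 'cV[rat]_n) :
  c *m E = perm_mx s -> Z = perm_mx s *m c^T -> c *m x = const_mx 1 ->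
  Z \in unitmx /\ magnitude Z = \sum_k x k 0.
Proof.
move=> cE ZE cx; have uc : c \in unitmx.
  have [] := @mulmx1_unit _ _ c (E *m perm_mx s^-1%g) => //.
  by rewrite mulmxA cE -perm_mxM mulgV perm_mx1.
have uZ : Z \in unitmx by rewrite ZE unitmx_mul unitmx_perm unitmx_tr.
split=> //; pose u : 'cV[rat]_n := const_mx 1.
have su : perm_mx s *m u = u by rewrite -row_permE; apply/matrixP => i j; rewrite !mxE.
have Zu : invmx Z *m u = invmx c^T *m u.
  apply: (can_inj (mulKmx uZ)); rewrite mulKVmx // ZE -!mulmxA mulKVmx ?su //.
  by rewrite unitmx_tr.
have -> : magnitude Z = (u^T *m (invmx Z *m u)) 0 0.
  rewrite !mxE; apply: eq_bigr => i _; rewrite !mxE mul1r.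
  by apply: eq_bigr => j _; rewrite !mxE mulr1.
have -> : u^T = x^T *m c^T by rewrite -trmx_mul cx.
rewrite Zu -mulmxA mulKVmx ?unitmx_tr // !mxE.
by apply: eq_bigr => k _; rewrite !mxE mulr1.
Qed.

(** * The additive functions dim Hom(P, -) and chi(-, N) *)

Section Additive.
Variables (K : fieldType) (A : falgType K).
Implicit Types M N P : amod A.

Lemma additive_homdim P : is_amod P -> projective P ->
  additive_fun (fun M => (homdim P M)%:R).
Proof.
move=> PP projP M' M M'' i p MM' MM MM'' e.
by rewrite (homdim_projective_add PP MM' MM MM'' projP e) natrD.
Qed.

Lemma additive_euler n0 N : is_amod N ->
  (forall M, is_amod M -> ext_vanish n0 M N) -> additive_fun (fun M => euler M N n0).
Proof. by move=> NN van M' M M'' i p MM' MM MM'' e; apply: euler_add e _ _ _; auto. Qed.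

Lemma homdim_iso_neq0 M N X : is_amod M -> is_amod N -> is_amod X -> iso M N ->
  homdim M X <> 0%N -> homdim N X <> 0%N.
Proof.
move=> MM NN XX [f [g [hf hg fg gf]]] /(homdim_neq0P MM XX) [h [hh h0]].
apply/(homdim_neq0P NN XX); exists (g *m h); split; first exact: is_hom_comp hg hh.
by apply: contraNneq h0 => gh; rewrite -[h]mul1mx -fg -mulmxA gh mulmx0.
Qed.

End Additive.

(** * Finiteness of I, invertibility of Z and the alternating sum *)

Theorem theorem1p1 (K : closedFieldType) (A : falgType K)
  (gldimA : finite_gldim A)
  (I : Type) (P S : I -> amod A)
  (P_mod : forall i, is_amod (P i))
  (P_ind : forall i, indecomposable (P i))
  (P_proj : forall i, projective (P i))
  (P_noniso : forall i j, iso (P i) (P j) -> i = j)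
  (P_all : forall M : amod A, is_amod M -> indecomposable M -> projective M ->
             exists i, iso M (P i))
  (S_mod : forall i, is_amod (S i))
  (S_simple : forall i, simple (S i))
  (S_noniso : forall i j, iso (S i) (S j) -> i = j)
  (S_all : forall M : amod A, is_amod M -> simple M -> exists i, iso M (S i)) :
  exists (n : nat) (e : 'I_n -> I),
    bijective e /\
    let Z : 'M[rat]_n := \matrix_(i < n, j < n) (homdim (P (e i)) (P (e j)))%:R in
    let SS : amod A := bigdsum [seq S (e i) | i <- enum 'I_n] in
    Z \in unitmx /\
    forall N : nat, (forall k, (N <= k)%N -> extdim SS SS k = 0%N) ->
      magnitude Z = \sum_(k < N) (-1) ^+ k * (extdim SS SS k)%:R.
Proof.
have homP i := additive_homdim (P_mod i) (P_proj i).
have comp := composition_series S_mod S_all.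
(* [top i] indexes the simple quotient of P_i; the claims below make [top] a bijection of I. *)
have [top topP] : {top : I -> I & forall i, homdim (P i) (S (top i)) <> 0%N}.
  apply: (@choice _ _ (fun i j => homdim (P i) (S j) <> 0%N)) => i.
  have [T [p [TT simT hp fullp]]] := simple_quotient (P_mod i) (P_ind i).1.
  have [j isoj] := S_all T TT simT; exists j => h0.
  have := additive_fun_iso (homP i) TT (S_mod j) isoj; rewrite h0 => /eqP.
  rewrite pnatr_eq0; apply/negP/eqP/(homdim_neq0P (P_mod i) TT); exists p; split=> //.
  by rewrite -mxrank_eq0 (eqP fullp) -lt0n; case: simT.
have top1 i : homdim (P i) (S (top i)) = 1%N by apply: homdim_top (topP i).
have topE i j : homdim (P i) (S j) <> 0%N -> j = top i.
  by move=> h; apply/S_noniso/(@top_unique _ _ (P i)).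
have top_inj i j : top i = top j -> i = j.
  move=> eqt; apply/P_noniso/(@proj_cover_unique _ _ _ _ (S (top i))) => //.
  by rewrite eqt.
(* S_j is a quotient of the free module A, so some indecomposable projective Q maps nontrivially to
   it, and Q is isomorphic to some P_i. *)
have top_surj j : exists i, top i = j.
  have [p [hp fullp]] := free1_simple_full (S_mod j) (S_simple j).
  have FF := freemod_amod A 1.
  have hFS : homdim (freemod A 1) (S j) <> 0%N.
    apply/(homdim_neq0P FF (S_mod j)); exists p; split=> //.
    by rewrite -mxrank_eq0 (eqP fullp) -lt0n; case: (S_simple j).
  have [Q [QQ indQ projQ hQ]] :=
    proj_cover_exists FF (@freemod_projective _ A 1) (S_mod j) hFS.
  have [i isoQ] := P_all Q QQ indQ projQ; exists i; apply/esym/topE.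
  exact: homdim_iso_neq0 isoQ hQ.
(* Finiteness of I: [s] lists the composition factors of A. If S_j with j = top i were missing,
   additivity would give Hom(P_i, A) = 0, whereas the surjection A -> S_j makes it nonzero.
   [{classic I}] supplies decidable equality. *)
have [s sP] : exists s : seq {classic I}, forall j, j \in s.
  have [s sE] := comp _ (freemod_amod A 1); exists s => j.
  have [i ij] := top_surj j; apply: contraT => js.
  have [p [hp fullp]] := free1_simple_full (S_mod j) (S_simple j).
  have FF := freemod_amod A 1; have invU := invariant_ker hp.
  have exact_p : @short_exact _ _ (submod (kermx p)) _ _ (row_base (kermx p)) p.
    split=> //; first exact: submod_hom.
      exact: row_base_free.
    split; first by apply/sub_kermxP; rewrite eq_row_base.
    by rewrite /= mxrank_ker (eqP fullp) subnK // -(eqP fullp) rank_leq_row.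
  have H : homdim (P i) (freemod A 1) <> 0%N.
    rewrite (homdim_projective_add _ _ FF _ (P_proj i) exact_p) //.
      by have := top1 i; rewrite ij => ->; rewrite addn1.
    exact: submod_amod FF invU.
  have := sE _ (homP i); rewrite /= (@big1_seq _ _ _ {classic I}) => [/eqP|k /andP[_ ks]].
    by rewrite pnatr_eq0 => /eqP.
  apply/eqP; rewrite pnatr_eq0; apply/negPn/negP => /eqP /topE kE.
  by move: js; rewrite -ij -kE ks.
have [n [e [f [ek ke]]]] : exists n (e : 'I_n -> I) (f : I -> 'I_n),
    cancel e f /\ cancel f e.
  pose t := undup s; exists (size t), (fun k => tnth (in_tuple t) k).
  have it (j : {classic I}) : (index j t < size t)%N by rewrite index_mem mem_undup.
  exists (fun j => Ordinal (it j)); split=> [k|j].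
    by apply: val_inj; rewrite /= (tnth_nth (tnth (in_tuple t) k)) index_uniq ?undup_uniq.
  by rewrite (tnth_nth (j : {classic I})) /= nth_index // mem_undup.
exists n, e; split; first by exists f.
(* The cutoff n1 is a successor because [euler_projective] needs degree 0 to be included. *)
move=> Z SS; have [n0 van0] := gldimA; pose n1 := n0.+1.
have van (M N : amod A) : is_amod M -> is_amod N -> ext_vanish n1 M N.
  by move=> MM NN k lek; apply: van0 => //; exact: ltnW.
have SSS phi : additive_fun phi -> is_amod SS /\ phi SS = \sum_(k < n) phi (S (e k)).
  move=> addphi; have [h ->] := additive_fun_bigdsum (enum 'I_n) addphi (fun k => S_mod (e k)).
  by rewrite big_enum.
have SSm : is_amod SS.
  by have [] := SSS (fun=> 0); first by move=> *; rewrite addr0.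
have [cs csP] := choice (fun i => comp (P i) (P_mod i)).
(* [c i k] is the multiplicity of S_k in the chosen list of composition factors of P_i. *)
pose c : 'M[rat]_n := \matrix_(i, k) \sum_(j <- cs (e i)) (f j == k)%:R.
have cP phi i : additive_fun phi -> phi (P (e i)) = \sum_k c i k * phi (S (e k)).
  move=> addphi; rewrite csP //.
  under [RHS]eq_bigr do rewrite mxE mulr_suml.
  rewrite exchange_big /=; apply: eq_bigr => j _; rewrite (bigD1 (f j)) //= eqxx mul1r ke.
  by rewrite big1 ?addr0 // => k; rewrite eq_sym => /negbTE ->; rewrite mul0r.
have sinj : injective (fun i => f (top (e i))).
  by move=> i j /(can_inj ke) /top_inj /(can_inj ek).
have DE i j : (homdim (P (e i)) (S (e j)))%:R = perm_mx (perm sinj) i j :> rat.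
  rewrite !mxE permE; case: eqP => [<-|ne]; first by rewrite ke top1.
  apply/eqP; rewrite pnatr_eq0; apply/negPn/negP => /eqP /topE ej.
  by apply: ne; rewrite -ej ek.
(* chi(P_i, M) is computed in two ways: by projectivity of P_i and through its composition
   factors. *)
have chiP M i : is_amod M -> (homdim (P (e i)) M)%:R = \sum_k c i k * euler (S (e k)) M n1.
  move=> MM; have <- := cP _ i (additive_euler MM (fun M' MM' => van M' M MM' MM)).
  by rewrite euler_projective.
pose E : 'M[rat]_n := \matrix_(k, j) euler (S (e k)) (S (e j)) n1.
pose x : 'cV[rat]_n := \col_k euler (S (e k)) SS n1.
have [|||uZ magZ] := @magnitude_factor n (perm sinj) Z c E x.
(* c E = D, by taking M = S_j in [chiP]. *)
- apply/matrixP => i j; rewrite -DE chiP // mxE.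
  by apply: eq_bigr => k _; rewrite !mxE.
(* Z = D c^T, by expanding P_j into composition factors inside Hom(P_i, -). *)
- apply/matrixP => i j; rewrite !mxE (cP _ _ (homP (e i))).
  by apply: eq_bigr => k _; rewrite DE mulrC [c^T _ _]mxE.
(* c x = u, because the top of P_i occurs exactly once in S, so that dim Hom(P_i, S) = 1. *)
- apply/matrixP => i j; rewrite !mxE.
  transitivity ((homdim (P (e i)) SS)%:R : rat).
    by rewrite chiP //; apply: eq_bigr => k _; rewrite [x _ _]mxE.
  have [_ ->] := SSS _ (homP (e i)).
  rewrite (bigD1 (f (top (e i)))) //= ke top1 big1 ?addr0 // => k nk.
  by rewrite DE !mxE permE eq_sym (negbTE nk).
split=> // N vanN; rewrite magZ.
have -> : \sum_k x k 0 = euler SS SS n1.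
  have [_ ->] := SSS _ (additive_euler SSm (fun M MM => van M SS MM SSm)).
  by apply: eq_bigr => k _; rewrite mxE.
(* The cutoffs [N] and [n1] are compared at their maximum. *)
rewrite -(euler_stable (van _ _ SSm SSm) (leq_maxr N n1)).
by rewrite (euler_stable vanN (leq_maxl N n1)).
Qed.
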